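(* Consider the noiseless multiple-access channel with states $Y=X_1\oplus_4S_1\oplus_4X_2\oplus_4S_2$, where all variables take values in $\mathbb{Z}_4$, $\oplus_4$ is addition modulo 4, and the states $S_1,S_2$ are independent and uniform on $\mathbb{Z}_4$. Let the cost functions be $c_1(x)=1$ if $x\in\{1,3\}$ and $c_1(x)=0$ otherwise, and $c_2(x)=1$ if $x\in\{2,3\}$ and $c_2(x)=0$ otherwise, with cost constraints $\mathbb{E}\{c_1(X_1)\}=\mathbb{E}\{c_2(X_2)\}=0$. Then every rate pair $(R_1,R_2)$ in the Gel'fand-Pinsker region of this channel (with these cost constraints) satisfies $R_1+R_2\le0.32$.
   Context: Rates and mutual informations are in bits (base 2). The Gel'fand-Pinsker region (natural extension of the Gel'fand-Pinsker scheme to the MAC) of a two-user MAC $p(y|x_1,x_2,s_1,s_2)$ with independent states $S_1,S_2$, state $S_i$ known non-causally at transmitter $i$, is the closure of the convex hull of the set of all pairs $(R_1,R_2)$ of nonnegative reals satisfying $$\begin{aligned}R_1&\le I(U_1;Y|U_2,Q)-I(U_1;S_1|Q),\\ R_2&\le I(U_2;Y|U_1,Q)-I(U_2;S_2|Q),\\ R_1+R_2&\le I(U_1,U_2;Y|Q)-I(U_1;S_1|Q)-I(U_2;S_2|Q)\end{aligned}$$ for some random variables $Q,U_1,U_2$ (with finite alphabets) and $X_1,X_2$, whose joint pmf with $(S_1,S_2,Y)$ factors as $p(q)p(s_1)p(s_2)\prod_{i=1,2}p(u_i,x_i|s_i,q)\,p(y|x_1,x_2,s_1,s_2)$ and which satisfy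 the cost constraints. In the present channel the cost constraints mean that, with probability one, $X_1\in\{0,2\}$ and $X_2\in\{0,1\}$. *)

(* Defs.v *)
From HB Require Import structures.
From mathcomp Require Import all_boot all_order all_algebra.
From mathcomp Require Import all_classical all_reals all_analysis.

Set Implicit Arguments.
Unset Strict Implicit.
Unset Printing Implicit Defensive.

Import Order.TTheory GRing.Theory Num.Theory.
Import numFieldNormedType.Exports.

Local Open Scope classical_set_scope.
Local Open Scope ring_scope.

Definition log2 (R : realType) (x : R) : R := ln x / ln 2.

Definition is_pmf (R : realType) (A : finType) (p : A -> R) : Prop :=
  (forall a, 0 <= p a) /\ \sum_a p a = 1.

Definition uniform_pmf (R : realType) (A : finType) (a : A) : R := #|A|%:R^-1.

Section RandomVariables.
Variables (R : realType) (T : finType) (P : T -> R).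

Definition pmf_of (A : finType) (X : T -> A) (a : A) : R :=
  \sum_(t | X t == a) P t.

Definition mean (f : T -> R) : R := \sum_t P t * f t.

(* I(X;Y|Z) in bits.  Whenever p(x,y,z) > 0 the three marginals below are
   positive; a triple with p(x,y,z) = 0 contributes 0. *)
Definition cond_mutual_info (A B C : finType)
    (X : T -> A) (Y : T -> B) (Z : T -> C) : R :=
  \sum_(x : A) \sum_(y : B) \sum_(z : C)
    let pxyz := pmf_of (fun t => (X t, Y t, Z t)) (x, y, z) in
    let pxz := pmf_of (fun t => (X t, Z t)) (x, z) in
    let pyz := pmf_of (fun t => (Y t, Z t)) (y, z) in
    let pz := pmf_of Z z in
    pxyz * log2 ((pxyz * pz) / (pxz * pyz)).

End RandomVariables.

Definition convex_hull (R : realType) (M : lmodType R) (A : set M) : set M :=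
  smallest (@convex_set R M) A.

Section GelfandPinsker.
Variables (R : realType) (AX1 AX2 AS1 AS2 AY : finType).
(* W x1 x2 s1 s2 y is p(y | x1, x2, s1, s2). *)
Variable W : AX1 -> AX2 -> AS1 -> AS2 -> AY -> R.
Variables (pS1 : AS1 -> R) (pS2 : AS2 -> R).
Variables (c1 : AX1 -> R) (c2 : AX2 -> R).

(* Kernels p(u,x|s,q) are written k s q (u, x). *)
Definition gp_factorization (AQ AU1 AU2 T : finType) (P : T -> R)
    (Q : T -> AQ) (S1 : T -> AS1) (S2 : T -> AS2) (U1 : T -> AU1)
    (U2 : T -> AU2) (X1 : T -> AX1) (X2 : T -> AX2) (Y : T -> AY) : Prop :=
  exists (pQ : AQ -> R) (k1 : AS1 -> AQ -> AU1 * AX1 -> R)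
         (k2 : AS2 -> AQ -> AU2 * AX2 -> R),
    [/\ is_pmf pQ,
        (forall s q, is_pmf (k1 s q)),
        (forall s q, is_pmf (k2 s q)) &
        forall q s1 s2 u1 u2 x1 x2 y,
          pmf_of P
            (fun t => (Q t, S1 t, S2 t, U1 t, U2 t, X1 t, X2 t, Y t))
            (q, s1, s2, u1, u2, x1, x2, y)
          = pQ q * pS1 s1 * pS2 s2 * k1 s1 q (u1, x1) * k2 s2 q (u2, x2)
            * W x1 x2 s1 s2 y].

(* Every alphabet is finite, so the random variables can be taken on a finite
   probability space (T, P).  The cost constraints are those of zero expected
   cost. *)
Definition gp_pairs : set (R^o * R^o) := [set r |
  exists (AQ AU1 AU2 T : finType) (P : T -> R)
         (Q : T -> AQ) (S1 : T -> AS1) (S2 : T -> AS2) (U1 : T -> AU1)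
         (U2 : T -> AU2) (X1 : T -> AX1) (X2 : T -> AX2) (Y : T -> AY),
    let I A B C := @cond_mutual_info R T P A B C in
    [/\ is_pmf P,
        gp_factorization P Q S1 S2 U1 U2 X1 X2 Y,
        (mean P (fun t => c1 (X1 t)) = 0) /\
        (mean P (fun t => c2 (X2 t)) = 0),
        (0 <= r.1) /\ (0 <= r.2) &
        [/\ r.1 <= I _ _ _ U1 Y (fun t => (U2 t, Q t)) - I _ _ _ U1 S1 Q,
            r.2 <= I _ _ _ U2 Y (fun t => (U1 t, Q t)) - I _ _ _ U2 S2 Q &
            r.1 + r.2 <= I _ _ _ (fun t => (U1 t, U2 t)) Y Q
                         - I _ _ _ U1 S1 Q - I _ _ _ U2 S2 Q]]].

Definition gp_region : set (R^o * R^o) := closure (convex_hull gp_pairs).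

End GelfandPinsker.

Definition noiseless_mac4 (R : realType) (x1 x2 s1 s2 y : 'Z_4) : R :=
  (y == x1 + s1 + x2 + s2)%:R.

Definition cost1 (R : realType) (x : 'Z_4) : R :=
  if (x == 1) || (x == 3) then 1 else 0.

Definition cost2 (R : realType) (x : 'Z_4) : R :=
  if (x == 2) || (x == 3) then 1 else 0.

(* Main.v *)
(* Since H(Y|Q) is at most 2 bits and each S_i is uniform and independent of Q, the
   third rate bound is at most H(S1|U1,Q) + H(S2|U2,Q) - H(Y|U1,U2,Q) - 2.  Fix values of
   Q, U1, U2: then (S1,X1) and (S2,X2) are independent, Y = V1 + V2 with V_i = S_i + X_i,
   and it suffices that H(S1) + H(S2) - H(Y) <= 2.32 bits.

   As X1 is even, V1 has the parity of S1, so H(S1) <= 1 + h(m) with m = P(V1 even).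
   The function -H(Y) is convex in the law of V1 and in each P(X2 = 1 | S2 = s), hence
   one may assume that V1 is carried by two adjacent points and that X2 is a
   deterministic function of S2.  Then the claim reads H(V1|Y) + H(S2|V2) <= 1.32.  If S2 -> V2
   is injective, or merges two pairs of states, it is immediate with 1 in place of 1.32.
   Otherwise exactly two states are merged, and H(V1|Y) is bounded by Gibbs'
   inequality with explicit rational conditional laws of V1 given Y. *)
Require Import Defs.
From mathcomp Require Import all_boot all_order all_algebra.
From mathcomp Require Import all_classical all_reals all_analysis.
From mathcomp Require Import ring lra.
Import Order.TTheory GRing.Theory Num.Theory.
Import numFieldNormedType.Exports.
Local Open Scope classical_set_scope.
Local Open Scope ring_scope.

(** * The function x ln x *)

Lemma ln2_gt0 {R : realType} : 0 < ln 2 :> R.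
Proof. by rewrite ln_gt0// ltr1n. Qed.

Definition xlnx {R : realType} (x : R) : R := x * ln x.

Lemma xlnx0 {R : realType} : xlnx (0 : R) = 0.
Proof. by rewrite /xlnx mul0r. Qed.

Lemma xlnxM {R : realType} (x y : R) : 0 <= x -> 0 <= y ->
  xlnx (x * y) = y * xlnx x + x * xlnx y.
Proof.
rewrite /xlnx !le_eqVlt => /predU1P[<-|x0]; first by rewrite !(mul0r, mulr0, addr0).
move=> /predU1P[<-|y0]; first by rewrite !(mul0r, mulr0, addr0).
rewrite lnM ?posrE//; ring.
Qed.

(** Gibbs' inequality for the two masses [x], [y] against the guess ([q], [1 - q]): it comes from ln
    u <= u - 1, applied once for each mass. *)
Lemma xlnxD {R : realType} (q x y : R) : 0 < q < 1 -> 0 <= x -> 0 <= y ->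
  xlnx (x + y) <= xlnx x + xlnx y - x * ln q - y * ln (1 - q).
Proof.
move=> /andP[q0 q1]; have q'0 : 0 < 1 - q by rewrite subr_gt0.
have lnq : ln q <= 0 by rewrite ln_le0// ltW.
have lnq' : ln (1 - q) <= 0 by rewrite ln_le0// gerBl ltW.
rewrite !le_eqVlt => /predU1P[<- y0|x0 /predU1P[<-|y0]].
- have : 0 <= y by case/predU1P: y0 => [<-//|/ltW].
  rewrite xlnx0 !add0r; nra.
- rewrite xlnx0 !addr0; nra.
- have xy0 : 0 < x + y by rewrite addr_gt0.
  suff key (a r : R) : 0 < a -> 0 < r -> a * (ln (x + y) + ln r - ln a) <= (x + y) * r - a.
    have := key _ _ x0 q0; have := key _ _ y0 q'0; rewrite /xlnx; nra.
  move=> a0 r0; have u0 : 0 < (x + y) * r / a by rewrite !mulr_gt0 ?invr_gt0.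
  have : ln (1 + ((x + y) * r / a - 1)) <= (x + y) * r / a - 1.
    by rewrite le_ln1Dx// ltrBrDl subrr.
  rewrite addrC subrK ln_div ?lnM ?posrE ?mulr_gt0// => H.
  have := ler_wpM2l (ltW a0) H.
  by rewrite [leRHS]mulrBr mulrCA divff ?gt_eqF// !mulr1.
Qed.

(** Gibbs' inequality for the masses [x * a] and [(1 - x) * b] with the guess [x]: the logarithms of
    the weights cancel and convexity remains. *)
Lemma xlnx_conv {R : realType} (x a b : R) : 0 <= x <= 1 -> 0 <= a -> 0 <= b ->
  xlnx (x * a + (1 - x) * b) <= x * xlnx a + (1 - x) * xlnx b.
Proof.
move=> /andP[]; rewrite le_eqVlt => /predU1P[<- _ _ _|x0].
  by rewrite subr0 !mul0r !add0r !mul1r.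
rewrite le_eqVlt => /predU1P[-> _ _|x1 a0 b0].
  by rewrite subrr !mul0r !addr0 !mul1r.
have x'0 : 0 < 1 - x by rewrite subr_gt0.
have x01 : 0 < x < 1 by rewrite x0.
have := xlnxD _ _ _ x01 (mulr_ge0 (ltW x0) a0) (mulr_ge0 (ltW x'0) b0).
rewrite (xlnxM x a (ltW x0) a0) (xlnxM (1 - x) b (ltW x'0) b0).
rewrite /(xlnx x) /(xlnx (1 - x)); lra.
Qed.

(** * Rational certificates for one collision of states *)

Lemma ln_le_log2 {R : realType} (m n : nat) (a : R) : 0 < a -> (0 < n)%N ->
  1 <= 2 ^+ m * a ^+ n -> - ln a <= m%:R / n%:R * ln 2.
Proof.
move=> a0 n0 h; have a2 : 0 < 2 ^+ m * a ^+ n by rewrite mulr_gt0 ?exprn_gt0.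
have : ln (1 : R) <= ln (2 ^+ m * a ^+ n) by rewrite ler_ln ?posrE.
rewrite ln1 lnM ?posrE ?exprn_gt0// !lnXn// -[_ *+ m]mulr_natl -[_ *+ n]mulr_natl => h1.
have n0' : 0 < n%:R :> R by rewrite ltr0n.
rewrite mulrAC ler_pdivlMr//; lra.
Qed.

(* Here [V1] is Bernoulli([t]), [V2] takes the values [0, 1, 2] with masses [p_i], and
   [E_i] is the sum of [x ln x] over the masses of the states mapped to [V2 = i]; take
   [n_i = 1] if two states collide at [i] and [n_i = 0] otherwise.  Gibbs'
   inequality is applied with the guesses [P(V1 = 1 | Y = 1) = a] and
   [P(V1 = 0 | Y = 2) = b]. *)
Lemma gibbs_certificate {R : realType} (a b la la' lb lb' n0 n1 n2 t p0 p1 p2 E0 E1 E2 : R) :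
  0 <= t <= 1 -> 0 <= p0 -> 0 <= p1 -> 0 <= p2 -> p0 + p1 + p2 = 1 ->
  0 < a < 1 -> 0 < b < 1 ->
  - ln a <= la * ln 2 -> - ln (1 - a) <= la' * ln 2 ->
  - ln b <= lb * ln 2 -> - ln (1 - b) <= lb' * ln 2 ->
  xlnx p0 <= E0 + n0 * p0 * ln 2 -> xlnx p1 <= E1 + n1 * p1 * ln 2 ->
  xlnx p2 <= E2 + n2 * p2 * ln 2 ->
  t * la + n0 <= 132 / 100 -> (1 - t) * la' + t * lb' + n1 <= 132 / 100 ->
  (1 - t) * lb + n2 <= 132 / 100 ->
  xlnx ((1 - t) * p0) + xlnx ((1 - t) * p1 + t * p0)
  + xlnx ((1 - t) * p2 + t * p1) + xlnx (t * p2) <=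
  132 / 100 * ln 2 + xlnx t + xlnx (1 - t) + E0 + E1 + E2.
Proof.
move=> /andP[t0 t1] p00 p10 p20 ps a01 b01 ha ha' hb hb' h0 h1 h2 c0 c1 c2.
have t'0 : 0 <= 1 - t by rewrite subr_ge0.
have L0 := @ln2_gt0 R.
have a01' : 0 < 1 - a < 1 by lra.
have := xlnxD _ ((1 - t) * p1) (t * p0) a01' (mulr_ge0 t'0 p10) (mulr_ge0 t0 p00).
have := xlnxD _ ((1 - t) * p2) (t * p1) b01 (mulr_ge0 t'0 p20) (mulr_ge0 t0 p10).
rewrite !xlnxM// subKr => k1 k2.
have tp0 := ler_wpM2l (mulr_ge0 t0 p00) ha.
have tp1 := ler_wpM2l (mulr_ge0 t0 p10) hb'.
have tp1' := ler_wpM2l (mulr_ge0 t'0 p10) ha'.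
have tp2 := ler_wpM2l (mulr_ge0 t'0 p20) hb.
(* Once the entropies of V1 and V2 are split off, the excess is linear in the [p_i], with
   coefficients bounded by [c0], [c1], [c2]; as the [p_i] sum to 1, it is at most 132/100 bits. *)
have d0 := ler_wpM2r (ltW L0) (ler_wpM2l p00 c0).
have d1 := ler_wpM2r (ltW L0) (ler_wpM2l p10 c1).
have d2 := ler_wpM2r (ltW L0) (ler_wpM2l p20 c2).
have e : p2 = 1 - p0 - p1 by lra.
move: k1 k2 tp0 tp1 tp1' tp2 d0 d1 d2 h0 h1 h2.
rewrite e; lra.
Qed.

Definition vertex_bound {R : realType} (t n0 n1 n2 : R) : Prop :=
  forall p0 p1 p2 E0 E1 E2 : R,
  0 <= p0 -> 0 <= p1 -> 0 <= p2 -> p0 + p1 + p2 = 1 ->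
  xlnx p0 <= E0 + n0 * p0 * ln 2 -> xlnx p1 <= E1 + n1 * p1 * ln 2 ->
  xlnx p2 <= E2 + n2 * p2 * ln 2 ->
  xlnx ((1 - t) * p0) + xlnx ((1 - t) * p1 + t * p0)
  + xlnx ((1 - t) * p2 + t * p1) + xlnx (t * p2) <=
  132 / 100 * ln 2 + xlnx t + xlnx (1 - t) + E0 + E1 + E2.

(** The reflections V1 -> 1 - V1 and V2 -> 2 - V2 send Y to 3 - Y and so only reverse the four
    output terms. *)
Lemma vertex_bound_mirror {R : realType} (t n0 n1 n2 : R) :
  vertex_bound (1 - t) n2 n1 n0 -> vertex_bound t n0 n1 n2.
Proof.
move=> h p0 p1 p2 E0 E1 E2 h0 h1 h2 hs g0 g1 g2.
have := h p2 p1 p0 E2 E1 E0 h2 h1 h0.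
rewrite subKr (addrC (t * p1)) (addrC (t * p0)) => /(_ _ g2 g1 g0) k.
have /k : p2 + p1 + p0 = 1 by lra.
lra.
Qed.

(* The quotients bound [log2] of [1/a], [1/(1-a)], [1/b], [1/(1-b)] from above. *)
Lemma vertex_bound_log2 {R : realType} (a b : R) (m m' k k' n n' l l' : nat) (n0 n1 n2 t : R) :
  0 <= t <= 1 -> 0 < a < 1 -> 0 < b < 1 ->
  (0 < n)%N -> (0 < n')%N -> (0 < l)%N -> (0 < l')%N ->
  1 <= 2 ^+ m * a ^+ n -> 1 <= 2 ^+ m' * (1 - a) ^+ n' ->
  1 <= 2 ^+ k * b ^+ l -> 1 <= 2 ^+ k' * (1 - b) ^+ l' ->
  t * (m%:R / n%:R) + n0 <= 132 / 100 ->
  (1 - t) * (m'%:R / n'%:R) + t * (k'%:R / l'%:R) + n1 <= 132 / 100 ->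
  (1 - t) * (k%:R / l%:R) + n2 <= 132 / 100 ->
  vertex_bound t n0 n1 n2.
Proof.
move=> t01 /[dup] a01 /andP[a0 a1] /[dup] b01 /andP[b0 b1] *.
have a'0 : 0 < 1 - a by rewrite subr_gt0.
have b'0 : 0 < 1 - b by rewrite subr_gt0.
move=> p0 p1 p2 E0 E1 E2 *.
by apply: (gibbs_certificate a b (m%:R / n%:R) (m'%:R / n'%:R) (k%:R / l%:R) (k'%:R / l'%:R)
    n0 n1 n2) => //; exact: ln_le_log2.
Qed.

(* For fixed [a] and [b] the requirements of [vertex_bound_log2] are linear in [t], so
   each of a few intervals of [t] admits a constant rational choice. *)
Lemma vertex_bound_middle {R : realType} (t : R) : 0 <= t <= 1 -> vertex_bound t 0 1 0.
Proof.
(* A collision at the middle point is invariant under the reflection. *)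
wlog t12 : t / t <= 1 / 2.
  move=> h t01; have [/h/(_ t01)//|t12] := lerP t (1 / 2).
  by apply: vertex_bound_mirror; apply: h; lra.
move=> t01; have [t1|t1] := lerP t (1 / 4).
  by apply: (vertex_bound_log2 (1 / 32) (1 / 2) 5 1 1 1 1 16 1 1) => //; lra.
have [t2|t2] := lerP t (2 / 5).
  by apply: (vertex_bound_log2 (1 / 9) (3 / 10) 16 3 7 8 5 17 4 15) => //; lra.
by apply: (vertex_bound_log2 (1 / 6) (2 / 9) 13 3 11 4 5 11 5 11) => //; lra.
Qed.

Lemma vertex_bound_left {R : realType} (t : R) : 0 <= t <= 1 -> vertex_bound t 1 0 0.
Proof.
(* The collision takes one bit and leaves [t] log2(1/a) <= 0.32: the guess a = 1/2 serves up to
   8/25, and a = 2/3, where log2(3/2) <= 10/17, up to 27/50. *)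
move=> t01; have [t1|t1] := lerP t (8 / 25).
  by apply: (vertex_bound_log2 (1 / 2) (1 / 2) 1 1 1 1 1 1 1 1) => //; lra.
have [t2|t2] := lerP t (27 / 50).
  by apply: (vertex_bound_log2 (2 / 3) (1 / 3) 10 8 8 10 17 5 5 17) => //; lra.
by apply: (vertex_bound_log2 (5 / 6) (1 / 7) 3 13 20 5 11 5 7 22) => //; lra.
Qed.

Lemma vertex_bound_right {R : realType} (t : R) : 0 <= t <= 1 -> vertex_bound t 0 0 1.
Proof. by move=> t01; apply/vertex_bound_mirror/vertex_bound_left; lra. Qed.

(** * Entropy of a sum of independent variables on Z/4 *)

(** The uniform guess: a binary choice carries at most one bit per unit of mass. *)
Lemma xlnxD_half {R : realType} (x y : R) : 0 <= x -> 0 <= y ->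
  xlnx (x + y) <= xlnx x + xlnx y + (x + y) * ln 2.
Proof.
move=> x0 y0; have h : 0 < (2^-1 : R) < 1 by lra.
have := xlnxD _ _ _ h x0 y0.
rewrite (_ : 1 - 2^-1 = 2^-1 :> R); last by lra.
rewrite lnV ?posrE//; lra.
Qed.

(* Minus the entropy, in nats, of the cyclic convolution on Z/4 of the laws [v], [w]. *)
Definition neg_entropy_conv {R : realType} (v0 v1 v2 v3 w0 w1 w2 w3 : R) : R :=
  xlnx (v0 * w0 + v1 * w3 + v2 * w2 + v3 * w1)
  + xlnx (v0 * w1 + v1 * w0 + v2 * w3 + v3 * w2)
  + xlnx (v0 * w2 + v1 * w1 + v2 * w0 + v3 * w3)
  + xlnx (v0 * w3 + v1 * w2 + v2 * w1 + v3 * w0).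

Lemma neg_entropy_convC {R : realType} (v0 v1 v2 v3 w0 w1 w2 w3 : R) :
  neg_entropy_conv v0 v1 v2 v3 w0 w1 w2 w3 = neg_entropy_conv w0 w1 w2 w3 v0 v1 v2 v3.
Proof. by congr (xlnx _ + xlnx _ + xlnx _ + xlnx _); ring. Qed.

Lemma neg_entropy_conv_rot {R : realType} (v0 v1 v2 v3 w0 w1 w2 w3 : R) :
  neg_entropy_conv v0 v1 v2 v3 w0 w1 w2 w3 = neg_entropy_conv v1 v2 v3 v0 w0 w1 w2 w3.
Proof.
have addr_rot (x y z u : R) : x + y + z + u = y + z + u + x by ring.
rewrite [LHS]/neg_entropy_conv [LHS]addr_rot.
by congr (xlnx _ + xlnx _ + xlnx _ + xlnx _); ring.
Qed.

(** The output law is affine in the first law and [xlnx] is convex. The mixture enters through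
    equations, so that [ring] can check the decomposition at each use. *)
Lemma neg_entropy_conv_convex {R : realType}
    (x v0 v1 v2 v3 v0' v1' v2' v3' u0 u1 u2 u3 w0 w1 w2 w3 C : R) :
  u0 = x * v0 + (1 - x) * v0' -> u1 = x * v1 + (1 - x) * v1' ->
  u2 = x * v2 + (1 - x) * v2' -> u3 = x * v3 + (1 - x) * v3' ->
  0 <= x <= 1 -> 0 <= v0 -> 0 <= v1 -> 0 <= v2 -> 0 <= v3 ->
  0 <= v0' -> 0 <= v1' -> 0 <= v2' -> 0 <= v3' ->
  0 <= w0 -> 0 <= w1 -> 0 <= w2 -> 0 <= w3 ->
  neg_entropy_conv v0 v1 v2 v3 w0 w1 w2 w3 <= C ->
  neg_entropy_conv v0' v1' v2' v3' w0 w1 w2 w3 <= C ->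
  neg_entropy_conv u0 u1 u2 u3 w0 w1 w2 w3 <= C.
Proof.
move=> -> -> -> -> x01 v00 v10 v20 v30 v00' v10' v20' v30' w00 w10 w20 w30.
rewrite /neg_entropy_conv => h h'.
have E z0 z1 z2 z3 : (x * v0 + (1 - x) * v0') * z0 + (x * v1 + (1 - x) * v1') * z1
    + (x * v2 + (1 - x) * v2') * z2 + (x * v3 + (1 - x) * v3') * z3
  = x * (v0 * z0 + v1 * z1 + v2 * z2 + v3 * z3)
    + (1 - x) * (v0' * z0 + v1' * z1 + v2' * z2 + v3' * z3) by ring.
rewrite !E.
have K z0 z1 z2 z3 : 0 <= z0 -> 0 <= z1 -> 0 <= z2 -> 0 <= z3 ->
    xlnx (x * (v0 * z0 + v1 * z1 + v2 * z2 + v3 * z3)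
      + (1 - x) * (v0' * z0 + v1' * z1 + v2' * z2 + v3' * z3))
    <= x * xlnx (v0 * z0 + v1 * z1 + v2 * z2 + v3 * z3)
      + (1 - x) * xlnx (v0' * z0 + v1' * z1 + v2' * z2 + v3' * z3).
  by move=> *; apply: xlnx_conv => //; rewrite !addr_ge0 ?mulr_ge0.
have := K _ _ _ _ w00 w30 w20 w10; have := K _ _ _ _ w10 w00 w30 w20.
have := K _ _ _ _ w20 w10 w00 w30; have := K _ _ _ _ w30 w20 w10 w00.
have /andP[x0 x1] := x01; have x'0 : 0 <= 1 - x by rewrite subr_ge0.
have := ler_wpM2l x0 h; have := ler_wpM2l x'0 h'; lra.
Qed.

(* The law of [V1], with mass [m] on the even and [1 - m] on the odd residues, is a
   mixture of laws carried by two cyclically adjacent points. *)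
Lemma neg_entropy_conv_adjacent {R : realType} (m C a b w0 w1 w2 w3 : R) :
  0 <= m <= 1 -> 0 <= a <= 1 -> 0 <= b <= 1 ->
  0 <= w0 -> 0 <= w1 -> 0 <= w2 -> 0 <= w3 ->
  neg_entropy_conv m (1 - m) 0 0 w0 w1 w2 w3 <= C ->
  neg_entropy_conv (1 - m) m 0 0 w0 w1 w2 w3 <= C ->
  neg_entropy_conv (m * a) ((1 - m) * b) (m * (1 - a)) ((1 - m) * (1 - b)) w0 w1 w2 w3 <= C.
Proof.
move=> m01 a01 b01 w00 w10 w20 w30 h1 h2.
have [/andP[m0 m1] /andP[b0 b1]] := (m01, b01).
have m'0 : 0 <= 1 - m by rewrite subr_ge0.
have b'0 : 0 <= 1 - b by rewrite subr_ge0.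
(* Splitting by [a] moves all the even mass to 0 or to 2; splitting by [b] then moves the odd mass
   to 1 or to 3. Each of the four supports rotates to {0, 1}. *)
apply: (@neg_entropy_conv_convex _ a m ((1 - m) * b) 0 ((1 - m) * (1 - b))
  0 ((1 - m) * b) m ((1 - m) * (1 - b))); rewrite ?mulr_ge0//; try by ring.
- apply: (@neg_entropy_conv_convex _ b m (1 - m) 0 0 m 0 0 (1 - m)) => //; try by ring.
  by rewrite 3!neg_entropy_conv_rot.
- apply: (@neg_entropy_conv_convex _ b 0 (1 - m) m 0 0 0 m (1 - m)) => //; try by ring.
    by rewrite neg_entropy_conv_rot.
  by rewrite 2!neg_entropy_conv_rot.
Qed.

(* [b] is the law of [S2], [x_s] is [P(X2 = 1 | S2 = s)], and [V1] is Bernoulli([t]). *)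
Definition choice_conv {R : realType} (t b0 b1 b2 b3 x0 x1 x2 x3 : R) : R :=
  neg_entropy_conv ((1 - x0) * b0 + x3 * b3) ((1 - x1) * b1 + x0 * b0)
    ((1 - x2) * b2 + x1 * b1) ((1 - x3) * b3 + x2 * b2) (1 - t) t 0 0.

Lemma choice_conv_rot {R : realType} (t b0 b1 b2 b3 x0 x1 x2 x3 : R) :
  choice_conv t b0 b1 b2 b3 x0 x1 x2 x3 = choice_conv t b1 b2 b3 b0 x1 x2 x3 x0.
Proof. exact: neg_entropy_conv_rot. Qed.

(** The law of V2 is affine in [x0], so the convex function [choice_conv] is largest at an endpoint
    of [0, 1]. *)
Lemma choice_conv_extreme {R : realType} (C t b0 b1 b2 b3 x0 x1 x2 x3 : R) :
  0 <= t <= 1 -> 0 <= b0 -> 0 <= b1 -> 0 <= b2 -> 0 <= b3 ->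
  0 <= x0 <= 1 -> 0 <= x1 <= 1 -> 0 <= x2 <= 1 -> 0 <= x3 <= 1 ->
  (forall x, x = 0 \/ x = 1 -> choice_conv t b0 b1 b2 b3 x x1 x2 x3 <= C) ->
  choice_conv t b0 b1 b2 b3 x0 x1 x2 x3 <= C.
Proof.
move=> /andP[t0 t1] b00 b10 b20 b30 x001 /andP[x10 x11] /andP[x20 x21] /andP[x30 x31] h.
have t'0 : 0 <= 1 - t by rewrite subr_ge0.
have := h 0 (or_introl erefl); have := h 1 (or_intror erefl); rewrite /choice_conv => h1 h0.
apply: (neg_entropy_conv_convex x0 _ _ _ _ _ _ _ _ _ _ _ _ _ _ _ _ _ _ _ _ _
  _ _ _ _ _ _ _ _ _ _ _ _ _ h1 h0) => //; try by ring.
all: rewrite ?addr_ge0 ?mulr_ge0 ?subr_ge0 ?lexx ?ler01//.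
Qed.

(** * Deterministic choices of X2 given S2 *)

Lemma vertex_bound3 {R : realType} (t n0 n1 n2 p0 p1 p2 E0 E1 E2 : R) :
  vertex_bound t n0 n1 n2 ->
  0 <= p0 -> 0 <= p1 -> 0 <= p2 -> p0 + p1 + p2 = 1 ->
  xlnx p0 <= E0 + n0 * p0 * ln 2 -> xlnx p1 <= E1 + n1 * p1 * ln 2 ->
  xlnx p2 <= E2 + n2 * p2 * ln 2 ->
  neg_entropy_conv p0 p1 p2 0 (1 - t) t 0 0 <=
  132 / 100 * ln 2 + xlnx t + xlnx (1 - t) + E0 + E1 + E2.
Proof.
move=> H h0 h1 h2 hs g0 g1 g2; apply: le_trans (H _ _ _ _ _ _ h0 h1 h2 hs g0 g1 g2).
rewrite /neg_entropy_conv le_eqVlt; apply/orP; left; apply/eqP.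
by congr (xlnx _ + xlnx _ + xlnx _ + xlnx _); ring.
Qed.

(** Here [x] and [y] are the masses of the two merged states. V2 then misses one residue and lives
    on three consecutive ones; the collision may sit at the first, the middle or the last of
    them. *)
Lemma collision_left {R : realType} (t x y p q : R) : 0 <= t <= 1 ->
  0 <= x -> 0 <= y -> 0 <= p -> 0 <= q -> x + y + p + q = 1 ->
  neg_entropy_conv (x + y) p q 0 (1 - t) t 0 0 <=
  132 / 100 * ln 2 + xlnx t + xlnx (1 - t) + (xlnx x + xlnx y) + xlnx p + xlnx q.
Proof.
move=> t01 x0 y0 p0 q0 h; apply: (vertex_bound3 _ _ _ _ _ _ _ _ _ _ (vertex_bound_left _ t01));
  rewrite ?(addr_ge0, mul1r, mul0r, addr0)//.
exact: xlnxD_half.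
Qed.

Lemma collision_middle {R : realType} (t x y p q : R) : 0 <= t <= 1 ->
  0 <= x -> 0 <= y -> 0 <= p -> 0 <= q -> p + (x + y) + q = 1 ->
  neg_entropy_conv p (x + y) q 0 (1 - t) t 0 0 <=
  132 / 100 * ln 2 + xlnx t + xlnx (1 - t) + xlnx p + (xlnx x + xlnx y) + xlnx q.
Proof.
move=> t01 x0 y0 p0 q0 h; apply: (vertex_bound3 _ _ _ _ _ _ _ _ _ _ (vertex_bound_middle _ t01));
  rewrite ?(addr_ge0, mul1r, mul0r, addr0)//.
exact: xlnxD_half.
Qed.

Lemma collision_right {R : realType} (t x y p q : R) : 0 <= t <= 1 ->
  0 <= x -> 0 <= y -> 0 <= p -> 0 <= q -> p + q + (x + y) = 1 ->
  neg_entropy_conv p q (x + y) 0 (1 - t) t 0 0 <=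
  132 / 100 * ln 2 + xlnx t + xlnx (1 - t) + xlnx p + xlnx q + (xlnx x + xlnx y).
Proof.
move=> t01 x0 y0 p0 q0 h; apply: (vertex_bound3 _ _ _ _ _ _ _ _ _ _ (vertex_bound_right _ t01));
  rewrite ?(addr_ge0, mul1r, mul0r, addr0)//.
exact: xlnxD_half.
Qed.

(** V2 lives on {0, 2} and V1 on {0, 1}, so Y determines both; the only loss is H(S2|V2), at most
    one bit. *)
Lemma two_collisions {R : realType} (t x y p q : R) : 0 <= t <= 1 ->
  0 <= x -> 0 <= y -> 0 <= p -> 0 <= q -> x + y + p + q = 1 ->
  neg_entropy_conv (x + y) 0 (p + q) 0 (1 - t) t 0 0 <=
  132 / 100 * ln 2 + xlnx t + xlnx (1 - t) + (xlnx x + xlnx y) + (xlnx p + xlnx q).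
Proof.
move=> /andP[t0 t1] x0 y0 p0 q0 h; have t'0 : 0 <= 1 - t by rewrite subr_ge0.
rewrite /neg_entropy_conv !(mulr0, mul0r, add0r, addr0).
have xy0 := addr_ge0 x0 y0; have pq0 := addr_ge0 p0 q0.
rewrite !xlnxM//.
have := xlnxD_half _ _ x0 y0; have := xlnxD_half _ _ p0 q0; have := @ln2_gt0 R.
have -> : q = 1 - x - y - p by lra.
lra.
Qed.

(** V2 determines S2, and the only loss is H(V1|Y), at most one bit since V1 is binary. *)
Lemma no_collision {R : realType} (t x y p q : R) : 0 <= t <= 1 ->
  0 <= x -> 0 <= y -> 0 <= p -> 0 <= q -> x + y + p + q = 1 ->
  neg_entropy_conv x y p q (1 - t) t 0 0 <=
  132 / 100 * ln 2 + xlnx t + xlnx (1 - t) + xlnx x + xlnx y + xlnx p + xlnx q.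
Proof.
move=> /andP[t0 t1] x0 y0 p0 q0 h; have t'0 : 0 <= 1 - t by rewrite subr_ge0.
rewrite /neg_entropy_conv !(mulr0, mul0r, add0r, addr0).
have := xlnxD_half _ _ (mulr_ge0 x0 t'0) (mulr_ge0 q0 t0).
have := xlnxD_half _ _ (mulr_ge0 x0 t0) (mulr_ge0 y0 t'0).
have := xlnxD_half _ _ (mulr_ge0 y0 t0) (mulr_ge0 p0 t'0).
have := xlnxD_half _ _ (mulr_ge0 p0 t0) (mulr_ge0 q0 t'0).
rewrite !xlnxM//.
have := @ln2_gt0 R.
have -> : q = 1 - x - y - p by lra.
lra.
Qed.

(** Rotates until a residue missed by V2, if any, comes last, then picks the lemma by the position
    of the sums. The pattern with two sums must come first, since that of [collision_left] also
    matches it. *)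
Ltac vertex :=
  lazymatch goal with
  | h : is_true (0 <= ?t <= 1) |- context [neg_entropy_conv ?w0 ?w1 ?w2 ?w3] =>
    lazymatch constr:((w0, w1, w2, w3)) with
    | (@GRing.add _ ?x ?y, GRing.zero, @GRing.add _ ?p ?q, GRing.zero) =>
      have := @two_collisions _ t x y p q h
    | (@GRing.add _ ?x ?y, ?p, ?q, GRing.zero) => have := @collision_left _ t x y p q h
    | (?p, @GRing.add _ ?x ?y, ?q, GRing.zero) => have := @collision_middle _ t x y p q h
    | (?p, ?q, @GRing.add _ ?x ?y, GRing.zero) => have := @collision_right _ t x y p q h
    | (GRing.zero, _, _, _) => rewrite neg_entropy_conv_rot; vertex
    | (_, GRing.zero, _, _) => rewrite neg_entropy_conv_rot; vertex
    | (_, _, GRing.zero, _) => rewrite neg_entropy_conv_rot; vertex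
    | (?x, ?y, ?p, ?q) => have := @no_collision _ t x y p q h
    end
  end.

Lemma choice_conv_vertex {R : realType} (t b0 b1 b2 b3 x0 x1 x2 x3 : R) :
  0 <= t <= 1 -> 0 <= b0 -> 0 <= b1 -> 0 <= b2 -> 0 <= b3 -> b0 + b1 + b2 + b3 = 1 ->
  x0 = 0 \/ x0 = 1 -> x1 = 0 \/ x1 = 1 -> x2 = 0 \/ x2 = 1 -> x3 = 0 \/ x3 = 1 ->
  choice_conv t b0 b1 b2 b3 x0 x1 x2 x3 <=
  132 / 100 * ln 2 + xlnx t + xlnx (1 - t) + xlnx b0 + xlnx b1 + xlnx b2 + xlnx b3.
Proof.
move=> t01 b00 b10 b20 b30 hb h0 h1 h2 h3.
rewrite /choice_conv.
(* As V2 is S2 or S2 + 1, only neighbouring states can merge: the sixteen maps have no collision,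
   one collision with one residue missed, or two collisions at opposite residues. *)
case: h0 => ->; case: h1 => ->; case: h2 => ->; case: h3 => ->;
  rewrite !(subr0, subrr, mul0r, mul1r, add0r, addr0).
all: vertex.
all: by move=> H; apply: le_trans (H _ _ _ _ _) _; clear H; lra.
Qed.

(** Provides conditional probabilities, also given a null event: if [b = 0] then [e = 0], and the
    quotient [e / b] is 0 by convention. *)
Lemma fraction_of {R : realType} (e b : R) : 0 <= e <= b -> exists2 x, 0 <= x <= 1 & e = x * b.
Proof.
move=> /andP[e0 eb]; have b0 := le_trans e0 eb; exists (e / b).
  rewrite divr_ge0//=; have [->|bn0] := eqVneq b 0; first by rewrite invr0 mulr0.
  by rewrite ler_pdivrMr ?mul1r// lt0r bn0.
have [b00|bn0] := eqVneq b 0; last by rewrite divfK.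
by apply/eqP; rewrite b00 mulr0 eq_le e0 -b00 eb.
Qed.

Lemma choice_conv_le {R : realType} (t b0 b1 b2 b3 x0 x1 x2 x3 : R) :
  0 <= t <= 1 -> 0 <= b0 -> 0 <= b1 -> 0 <= b2 -> 0 <= b3 -> b0 + b1 + b2 + b3 = 1 ->
  0 <= x0 <= 1 -> 0 <= x1 <= 1 -> 0 <= x2 <= 1 -> 0 <= x3 <= 1 ->
  choice_conv t b0 b1 b2 b3 x0 x1 x2 x3 <=
  132 / 100 * ln 2 + xlnx t + xlnx (1 - t) + xlnx b0 + xlnx b1 + xlnx b2 + xlnx b3.
Proof.
move=> t01 b00 b10 b20 b30 hb x001 x101 x201 x301.
have u01 (y : R) : y = 0 \/ y = 1 -> 0 <= y <= 1 by case=> ->; rewrite ?lexx ler01.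
(* Each rotation brings the next conditional probability to the front; the fourth restores the
   original order. *)
apply: choice_conv_extreme => // y0 hy0; have y001 := u01 _ hy0.
rewrite choice_conv_rot; apply: choice_conv_extreme => // y1 hy1; have y101 := u01 _ hy1.
rewrite choice_conv_rot; apply: choice_conv_extreme => // y2 hy2; have y201 := u01 _ hy2.
rewrite choice_conv_rot; apply: choice_conv_extreme => // y3 hy3; rewrite choice_conv_rot.
exact: choice_conv_vertex.
Qed.

(* [a], [v], [b] are the laws of [S1], [V1 = S1 + X1], [S2], and [e_s] is
   [P(S2 = s, X2 = 1)].  The only trace of [X1] being even is that [S1] and [V1] have the
   same parity. *)
Lemma neg_entropy_conv_le {R : realType}
    (a0 a1 a2 a3 v0 v1 v2 v3 b0 b1 b2 b3 e0 e1 e2 e3 : R) :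
  0 <= a0 -> 0 <= a1 -> 0 <= a2 -> 0 <= a3 -> a0 + a1 + a2 + a3 = 1 ->
  0 <= v0 -> 0 <= v1 -> 0 <= v2 -> 0 <= v3 -> v0 + v2 = a0 + a2 -> v1 + v3 = a1 + a3 ->
  0 <= e0 <= b0 -> 0 <= e1 <= b1 -> 0 <= e2 <= b2 -> 0 <= e3 <= b3 -> b0 + b1 + b2 + b3 = 1 ->
  neg_entropy_conv v0 v1 v2 v3
    (b0 - e0 + e3) (b1 - e1 + e0) (b2 - e2 + e1) (b3 - e3 + e2) <=
  232 / 100 * ln 2 + (xlnx a0 + xlnx a1 + xlnx a2 + xlnx a3)
  + (xlnx b0 + xlnx b1 + xlnx b2 + xlnx b3).
Proof.
move=> a00 a10 a20 a30 ha v00 v10 v20 v30 hv0 hv1 he0 he1 he2 he3 hb.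
have [b00 b10 b20 b30] : [/\ 0 <= b0, 0 <= b1, 0 <= b2 & 0 <= b3] by split; lra.
have [x0 x001 ex0] := fraction_of _ _ he0.
have [x1 x101 ex1] := fraction_of _ _ he1.
have [x2 x201 ex2] := fraction_of _ _ he2.
have [x3 x301 ex3] := fraction_of _ _ he3.
(* Together with [h1]: given its parity, S1 has at most one bit of entropy. *)
have h0 : xlnx (a0 + a2) <= xlnx a0 + xlnx a2 + (a0 + a2) * ln 2 by exact: xlnxD_half.
have h1 : xlnx (a1 + a3) <= xlnx a1 + xlnx a3 + (a1 + a3) * ln 2 by exact: xlnxD_half.
have [m em] : exists m, m = a0 + a2 by eexists.
have hm : a1 + a3 = 1 - m by lra.
have m01 : 0 <= m <= 1 by lra.
have hv0m : 0 <= v0 <= m by lra.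
have hv1m : 0 <= v1 <= 1 - m by lra.
rewrite -em in h0 hv0; rewrite hm in h1 hv1.
(* [a] is P(V1 = 0 | V1 even) and [b] is P(V1 = 1 | V1 odd). *)
have [a a01 ea] := fraction_of _ _ hv0m.
have [b b01 eb] := fraction_of _ _ hv1m.
have -> : v2 = m * (1 - a) by lra.
have -> : v3 = (1 - m) * (1 - b) by lra.
rewrite ea eb (mulrC a) (mulrC b).
set w0 := b0 - e0 + e3; set w1 := b1 - e1 + e0; set w2 := b2 - e2 + e1; set w3 := b3 - e3 + e2.
have h (t : R) : 0 <= t <= 1 -> neg_entropy_conv (1 - t) t 0 0 w0 w1 w2 w3 <=
    132 / 100 * ln 2 + xlnx t + xlnx (1 - t) + xlnx b0 + xlnx b1 + xlnx b2 + xlnx b3.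
  move=> t01; rewrite neg_entropy_convC.
  have -> : w0 = (1 - x0) * b0 + x3 * b3 by rewrite /w0 ex0 ex3; ring.
  have -> : w1 = (1 - x1) * b1 + x0 * b0 by rewrite /w1 ex1 ex0; ring.
  have -> : w2 = (1 - x2) * b2 + x1 * b1 by rewrite /w2 ex2 ex1; ring.
  have -> : w3 = (1 - x3) * b3 + x2 * b2 by rewrite /w3 ex3 ex2; ring.
  exact: choice_conv_le.
(* Both [t = m] and [t = 1 - m] are needed: an adjacent pair may begin with its even or with its odd
   point. *)
have m01' : 0 <= 1 - m <= 1 by lra.
have hm1 := h _ m01; have := h _ m01'; rewrite subKr => hm2.
have [w00 w10 w20 w30] : [/\ 0 <= w0, 0 <= w1, 0 <= w2 & 0 <= w3].
  by rewrite /w0 /w1 /w2 /w3; split; lra.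
clearbody w0 w1 w2 w3.
by apply: neg_entropy_conv_adjacent => //; lra.
Qed.

(** * The noiseless channel *)

Lemma sum_Z4 {V : nmodType} (F : 'Z_4 -> V) : \sum_z F z = F 0 + F 1 + F 2 + F 3.
Proof.
rewrite !big_ord_recl big_ord0 addr0 !addrA.
by congr (F _ + F _ + F _ + F _); apply: val_inj.
Qed.

Lemma sub_Z4 :
  (((0 - 0 = 0 :> 'Z_4) * (0 - 1 = 3 :> 'Z_4) * (0 - 2 = 2 :> 'Z_4) * (0 - 3 = 1 :> 'Z_4))
  * ((1 - 0 = 1 :> 'Z_4) * (1 - 1 = 0 :> 'Z_4) * (1 - 2 = 3 :> 'Z_4) * (1 - 3 = 2 :> 'Z_4))
  * ((2 - 0 = 2 :> 'Z_4) * (2 - 1 = 1 :> 'Z_4) * (2 - 2 = 0 :> 'Z_4) * (2 - 3 = 3 :> 'Z_4))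
  * ((3 - 0 = 3 :> 'Z_4) * (3 - 1 = 2 :> 'Z_4) * (3 - 2 = 1 :> 'Z_4) * (3 - 3 = 0 :> 'Z_4)))%type.
Proof. by do !split; apply: val_inj. Qed.

Lemma sum_Z4_noiseless {R : realType} (F : 'Z_4 -> R) (x1 x2 s1 y : 'Z_4) :
  \sum_s2 F s2 * noiseless_mac4 R x1 x2 s1 s2 y = F (y - x1 - s1 - x2).
Proof.
have E s : (y == x1 + s1 + x2 + s) = (s == y - x1 - s1 - x2) by apply/eqP/eqP => ->; ring.
rewrite (bigD1 (y - x1 - s1 - x2))//= big1 ?addr0 => [|s /negbTE sy].
  by rewrite /noiseless_mac4 E eqxx mulr1.
by rewrite /noiseless_mac4 E sy mulr0.
Qed.

Lemma sum_noiseless {R : realType} (x1 x2 s1 s2 : 'Z_4) :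
  \sum_y noiseless_mac4 R x1 x2 s1 s2 y = 1.
Proof.
rewrite /noiseless_mac4 (bigD1 (x1 + s1 + x2 + s2))//= eqxx big1 ?addr0//.
by move=> y /negbTE ->.
Qed.

Lemma sum_output {R : realType} (f h : 'Z_4 -> 'Z_4 -> R) :
  \sum_y \sum_s1 \sum_x1 \sum_x2 \sum_s2
    f s1 x1 * h s2 x2 * noiseless_mac4 R x1 x2 s1 s2 y
  = (\sum_s \sum_x f s x) * (\sum_s \sum_x h s x).
Proof.
rewrite mulr_suml exchange_big; apply: eq_bigr => s1 _.
rewrite mulr_suml exchange_big; apply: eq_bigr => x1 _.
rewrite exchange_big [in RHS]exchange_big mulr_sumr; apply: eq_bigr => x2 _.
rewrite exchange_big mulr_sumr; apply: eq_bigr => s2 _.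
by rewrite -mulr_sumr sum_noiseless mulr1.
Qed.

Lemma noiseless_neg_entropy_le {R : realType} (j1 j2 : 'Z_4 -> 'Z_4 -> R) :
  (forall s x, 0 <= j1 s x) -> (forall s x, 0 <= j2 s x) ->
  \sum_s \sum_x j1 s x = 1 -> \sum_s \sum_x j2 s x = 1 ->
  (forall s, j1 s 1 = 0) -> (forall s, j1 s 3 = 0) ->
  (forall s, j2 s 2 = 0) -> (forall s, j2 s 3 = 0) ->
  \sum_y xlnx (\sum_s1 \sum_x1 \sum_x2 \sum_s2
    j1 s1 x1 * j2 s2 x2 * noiseless_mac4 R x1 x2 s1 s2 y)
  <= 232 / 100 * ln 2 + \sum_s xlnx (\sum_x j1 s x) + \sum_s xlnx (\sum_x j2 s x).
Proof.
move=> j10 j20 h1 h2 j1_1 j1_3 j2_2 j2_3.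
(* [w] is the law of V2 = S2 + X2, where X2 is 0 or 1. *)
pose w z := j2 z 0 + j2 (z - 1) 1.
have E y : \sum_s1 \sum_x1 \sum_x2 \sum_s2
      j1 s1 x1 * j2 s2 x2 * noiseless_mac4 R x1 x2 s1 s2 y
    = \sum_s1 (j1 s1 0 * w (y - s1) + j1 s1 2 * w (y - 2 - s1)).
  apply: eq_bigr => s1 _.
  transitivity (\sum_x1 j1 s1 x1 * w (y - x1 - s1)).
    apply: eq_bigr => x1 _; under eq_bigr => x2 _ do
      rewrite (sum_Z4_noiseless (fun s2 => j1 s1 x1 * j2 s2 x2)).
    by rewrite sum_Z4 j2_2 j2_3 !mulr0 !addr0 -mulrDr subr0.
  by rewrite sum_Z4 j1_1 j1_3 !mul0r !addr0 subr0.
under eq_bigr => y _ do rewrite E.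
have J1 s : \sum_x j1 s x = j1 s 0 + j1 s 2 by rewrite sum_Z4 j1_1 j1_3 !addr0.
have J2 s : \sum_x j2 s x = j2 s 0 + j2 s 1 by rewrite sum_Z4 j2_2 j2_3 !addr0.
rewrite (eq_bigr _ (fun s _ => J1 s)) sum_Z4 in h1.
rewrite (eq_bigr _ (fun s _ => J2 s)) sum_Z4 in h2.
rewrite (eq_bigr _ (fun s _ => congr1 xlnx (J1 s))) (eq_bigr _ (fun s _ => congr1 xlnx (J2 s))).
rewrite !sum_Z4 !sub_Z4.
(* The four rows are the laws of S1, of V1 and of S2, and the masses P(S2 = s, X2 = 1). *)
have := @neg_entropy_conv_le _
  (j1 0 0 + j1 0 2) (j1 1 0 + j1 1 2) (j1 2 0 + j1 2 2) (j1 3 0 + j1 3 2)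
  (j1 0 0 + j1 2 2) (j1 1 0 + j1 3 2) (j1 2 0 + j1 0 2) (j1 3 0 + j1 1 2)
  (j2 0 0 + j2 0 1) (j2 1 0 + j2 1 1) (j2 2 0 + j2 2 1) (j2 3 0 + j2 3 1)
  (j2 0 1) (j2 1 1) (j2 2 1) (j2 3 1).
rewrite !addrK => H; apply: le_trans (H _ _ _ _ _ _ _ _ _ _ _ _ _ _ _ _) => //.
- rewrite le_eqVlt; apply/orP; left; apply/eqP.
  by rewrite /neg_entropy_conv /w !sub_Z4; congr (xlnx _ + xlnx _ + xlnx _ + xlnx _); ring.
all: first [by rewrite addr_ge0 | by rewrite j20 lerDr j20 | ring].
Qed.

(** The chain rule at one conditioning value of mass [m]. Normalisation is asked only for [m != 0],
    since conditional laws at null values are arbitrary. *)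
Lemma sum_xlnx_cond {R : realType} {A : finType} (m : R) (c : A -> R) :
  0 <= m -> (forall a, 0 <= c a) -> (m != 0 -> \sum_a c a = 1) ->
  \sum_a xlnx (m * c a) - xlnx m = m * \sum_a xlnx (c a).
Proof.
move=> m0 c0 c1; under eq_bigr => a _ do rewrite xlnxM//.
rewrite big_split/= -mulr_suml -mulr_sumr addrAC.
have [->|/c1 ->] := eqVneq m 0; first by rewrite xlnx0 mulr0 subrr add0r.
by rewrite mul1r subrr add0r.
Qed.

(** * Averaging over U1 and U2 at a fixed value of Q *)

Section FixedTimeSharing.
(* [p] is the probability of a value of [Q], and [g_i u s x] is the probability of
   [(U_i, S_i, X_i) = (u, s, x)] given that value. *)
Variables (R : realType) (AU1 AU2 : finType) (p : R).
Variables (g1 : AU1 -> 'Z_4 -> 'Z_4 -> R) (g2 : AU2 -> 'Z_4 -> 'Z_4 -> R).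
Hypotheses (p_ge0 : 0 <= p)
  (g1_ge0 : forall u s x, 0 <= g1 u s x) (g2_ge0 : forall u s x, 0 <= g2 u s x)
  (g1_sum : \sum_u \sum_s \sum_x g1 u s x = 1) (g2_sum : \sum_u \sum_s \sum_x g2 u s x = 1)
  (g1_cost : p != 0 -> forall u s, g1 u s 1 = 0 /\ g1 u s 3 = 0)
  (g2_cost : p != 0 -> forall u s, g2 u s 2 = 0 /\ g2 u s 3 = 0).

Let M1 u := \sum_s \sum_x g1 u s x.
Let M2 u := \sum_s \sum_x g2 u s x.
Let N u1 u2 y := \sum_s1 \sum_x1 \sum_x2 \sum_s2
  g1 u1 s1 x1 * g2 u2 s2 x2 * noiseless_mac4 R x1 x2 s1 s2 y.

(** The conditional law of (S1, X1) given U1 = [u]; division by zero makes it 0 when [u] is null. *)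
Let j1 u s x := g1 u s x / M1 u.
Let j2 u s x := g2 u s x / M2 u.

Let M1_ge0 u : 0 <= M1 u. Proof. by do 2!apply: sumr_ge0 => ? _. Qed.
Let M2_ge0 u : 0 <= M2 u. Proof. by do 2!apply: sumr_ge0 => ? _. Qed.
Let j1_ge0 u s x : 0 <= j1 u s x. Proof. by rewrite divr_ge0. Qed.
Let j2_ge0 u s x : 0 <= j2 u s x. Proof. by rewrite divr_ge0. Qed.

(** If the total is 0, nonnegativity makes every [f s x] vanish, so the factorisation survives
    division by zero. *)
Let divfK_sum (f : 'Z_4 -> 'Z_4 -> R) : (forall s x, 0 <= f s x) ->
  forall s x, f s x = (\sum_s \sum_x f s x) * (f s x / \sum_s \sum_x f s x).
Proof.
move=> f0 s x; have [M0|M0] := eqVneq (\sum_s \sum_x f s x) 0; last by rewrite mulrCA divff// mulr1.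
rewrite M0 mul0r; apply/eqP.
move/eqP: M0; rewrite psumr_eq0 => [/allP/(_ s)|? _]; last exact: sumr_ge0.
rewrite mem_index_enum => /(_ isT)/=; rewrite psumr_eq0// => /allP/(_ x).
by rewrite mem_index_enum => /(_ isT).
Qed.

Let j1E u s x : g1 u s x = M1 u * j1 u s x. Proof. exact: divfK_sum. Qed.
Let j2E u s x : g2 u s x = M2 u * j2 u s x. Proof. exact: divfK_sum. Qed.

Let j1_sum u : M1 u != 0 -> \sum_s \sum_x j1 u s x = 1.
Proof.
by move=> M0; under eq_bigr => s _ do rewrite -mulr_suml; rewrite -mulr_suml divff.
Qed.

Let j2_sum u : M2 u != 0 -> \sum_s \sum_x j2 u s x = 1.
Proof.
by move=> M0; under eq_bigr => s _ do rewrite -mulr_suml; rewrite -mulr_suml divff.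
Qed.

Let n u1 u2 y := \sum_s1 \sum_x1 \sum_x2 \sum_s2
  j1 u1 s1 x1 * j2 u2 s2 x2 * noiseless_mac4 R x1 x2 s1 s2 y.

Let NE u1 u2 y : N u1 u2 y = M1 u1 * M2 u2 * n u1 u2 y.
Proof.
rewrite /N /n mulr_sumr; apply: eq_bigr => s1 _; rewrite mulr_sumr; apply: eq_bigr => x1 _.
rewrite mulr_sumr; apply: eq_bigr => x2 _; rewrite mulr_sumr; apply: eq_bigr => s2 _.
by rewrite j1E j2E; ring.
Qed.

Let n_ge0 u1 u2 y : 0 <= n u1 u2 y.
Proof.
by do 4!apply: sumr_ge0 => ? _; exact: mulr_ge0 (mulr_ge0 (j1_ge0 _ _ _) (j2_ge0 _ _ _)) (ler0n _ _).
Qed.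

Let n_sum u1 u2 : M1 u1 != 0 -> M2 u2 != 0 -> \sum_y n u1 u2 y = 1.
Proof.
by move=> m1 m2; rewrite sum_output j1_sum ?j2_sum ?mulr1.
Qed.

(** Given Q, the variables U1 and U2 are independent, so H(S1|U1) + H(S2|U2) - H(Y|U1,U2) is an
    average over pairs (u1, u2) with weights [M1 u1 * M2 u2]; [noiseless_neg_entropy_le] bounds each
    pair of positive weight. *)
Lemma sum_neg_entropy_le :
  \sum_u1 \sum_u2 (\sum_y xlnx (p * N u1 u2 y) - xlnx (p * (M1 u1 * M2 u2)))
  - \sum_u1 (\sum_s xlnx (p * \sum_x g1 u1 s x) - xlnx (p * M1 u1))
  - \sum_u2 (\sum_s xlnx (p * \sum_x g2 u2 s x) - xlnx (p * M2 u2))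
  <= p * (232 / 100 * ln 2).
Proof.
have [p0|p0] := eqVneq p 0.
  have Z z : xlnx (0 * z) = 0 :> R by rewrite mul0r xlnx0.
  rewrite p0 mul0r !big1 ?subrr// => u1 _.
  - by rewrite big1 ?Z ?subrr// => s _; rewrite Z.
  - by rewrite big1 ?Z ?subrr// => s _; rewrite Z.
  - by rewrite big1// => u2 _; rewrite big1 ?Z ?subrr// => y _; rewrite Z.
pose S1 u := \sum_s xlnx (\sum_x j1 u s x).
pose S2 u := \sum_s xlnx (\sum_x j2 u s x).
(* As [M2] sums to 1, the term of the first user is spread over the pairs (u1, u2), ready for
   comparison pair by pair. *)
have B1 u : \sum_s xlnx (p * \sum_x g1 u s x) - xlnx (p * M1 u) = \sum_u2 p * M1 u * M2 u2 * S1 u.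
  rewrite -mulr_suml -mulr_sumr g2_sum mulr1 -sum_xlnx_cond ?mulr_ge0//; last 2 first.
  - by move=> s; exact: sumr_ge0.
  - by rewrite mulf_eq0 negb_or => /andP[_ /j1_sum].
  congr (_ - _); apply: eq_bigr => s _; rewrite -mulrA (mulr_sumr _ _ _ (M1 u)).
  by under eq_bigr do rewrite j1E.
have B2 u : \sum_s xlnx (p * \sum_x g2 u s x) - xlnx (p * M2 u) = \sum_u1 p * M1 u1 * M2 u * S2 u.
  rewrite -!mulr_suml -mulr_sumr g1_sum mulr1 -sum_xlnx_cond ?mulr_ge0//; last 2 first.
  - by move=> s; exact: sumr_ge0.
  - by rewrite mulf_eq0 negb_or => /andP[_ /j2_sum].
  congr (_ - _); apply: eq_bigr => s _; rewrite -mulrA (mulr_sumr _ _ _ (M2 u)).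
  by under eq_bigr do rewrite j2E.
have A u1 u2 : \sum_y xlnx (p * N u1 u2 y) - xlnx (p * (M1 u1 * M2 u2))
    = p * (M1 u1 * M2 u2) * \sum_y xlnx (n u1 u2 y).
  rewrite -sum_xlnx_cond ?mulr_ge0//; last first.
    by rewrite !mulf_eq0 !negb_or => /and3P[_ ]; exact: n_sum.
  by congr (_ - _); apply: eq_bigr => y _; rewrite NE mulrA.
under eq_bigr do under eq_bigr do rewrite A.
under [X in _ - X - _]eq_bigr do rewrite B1.
under [X in _ - _ - X]eq_bigr do rewrite B2.
rewrite [X in _ - _ - X]exchange_big/= -!sumrB.
have -> : p * (232 / 100 * ln 2) = \sum_u1 \sum_u2 p * (M1 u1 * M2 u2) * (232 / 100 * ln 2).
  under eq_bigr do rewrite -mulr_suml -mulr_sumr -mulr_sumr g2_sum mulr1.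
  by rewrite -mulr_suml -mulr_sumr g1_sum mulr1.
apply: ler_sum => u1 _; rewrite -!sumrB; apply: ler_sum => u2 _.
rewrite !(mulrA p) -!mulrBr.
have [m1|m1] := eqVneq (M1 u1) 0; first by rewrite m1 !(mul0r, mulr0).
have [m2|m2] := eqVneq (M2 u2) 0; first by rewrite m2 !(mul0r, mulr0).
apply: ler_wpM2l; first by rewrite !mulr_ge0.
rewrite !lerBlDr addrAC.
apply: noiseless_neg_entropy_le => //; try exact: j1_sum; try exact: j2_sum.
all: move=> s; rewrite ?/j1 ?/j2; have [] := g1_cost p0 u1 s; have [] := g2_cost p0 u2 s.
all: by move=> e1 e2 e3 e4; rewrite ?(e1, e2, e3, e4) mul0r.
Qed.
End FixedTimeSharing.

(** * Mutual information and the sum rate *)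

Section Marginals.
Variables (R : realType) (T : finType) (P : T -> R).
Hypothesis P_ge0 : forall t, 0 <= P t.

Lemma pmf_of_ge0 (A : finType) (X : T -> A) (a : A) : 0 <= pmf_of P X a.
Proof. exact: sumr_ge0. Qed.

Lemma pmf_of_marginal (A B : finType) (X : T -> A) (Y : T -> B) (a : A) :
  pmf_of P X a = \sum_b pmf_of P (fun t => (X t, Y t)) (a, b).
Proof.
rewrite /pmf_of (partition_big Y xpredT)//; exact: eq_bigr.
Qed.

Lemma pmf_of_le (A B : finType) (X : T -> A) (Y : T -> B) a b :
  (forall t, X t = a -> Y t = b) -> pmf_of P X a <= pmf_of P Y b.
Proof.
move=> XY; rewrite /pmf_of [leRHS]big_mkcond [leLHS]big_mkcond.
by apply: ler_sum => t _; case: eqP => [/XY ->|_]; [rewrite eqxx|case: ifP].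
Qed.

(** Where p(x,y,z) > 0 the logarithm splits into four, and null triples contribute 0; summing out
    the free variables leaves four entropies. The sum over [z] stays outermost so that each value of
    Q can be bounded separately. *)
Lemma cond_mutual_info_xlnx (A B C : finType) (X : T -> A) (Y : T -> B) (Z : T -> C) :
  cond_mutual_info P X Y Z * ln 2 = \sum_z
    (\sum_x \sum_y xlnx (pmf_of P (fun t => (X t, Y t, Z t)) (x, y, z))
     + xlnx (pmf_of P Z z)
     - \sum_x xlnx (pmf_of P (fun t => (X t, Z t)) (x, z))
     - \sum_y xlnx (pmf_of P (fun t => (Y t, Z t)) (y, z))).
Proof.
rewrite /cond_mutual_info; under eq_bigr => x _ do rewrite exchange_big /=.
rewrite exchange_big /= mulr_suml; apply: eq_bigr => z _.
pose pxyz x y := pmf_of P (fun t => (X t, Y t, Z t)) (x, y, z).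
pose pxz x := pmf_of P (fun t => (X t, Z t)) (x, z).
pose pyz y := pmf_of P (fun t => (Y t, Z t)) (y, z).
pose pz := pmf_of P Z z.
have term x y : pxyz x y * log2 (pxyz x y * pz / (pxz x * pyz y)) * ln 2
    = xlnx (pxyz x y) + pxyz x y * ln pz - pxyz x y * ln (pxz x) - pxyz x y * ln (pyz y).
  have L0 : ln 2 != 0 :> R by rewrite gt_eqF// ln2_gt0.
  rewrite /log2 -mulrA divfK//.
  have := pmf_of_ge0 _ (fun t => (X t, Y t, Z t)) (x, y, z).
  rewrite -/(pxyz x y) le_eqVlt => /predU1P[<-|p0]; first by rewrite xlnx0 !mul0r !subr0 addr0.
  have xz0 : 0 < pxz x by apply: lt_le_trans p0 _; apply: pmf_of_le => t [-> _ ->].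
  have yz0 : 0 < pyz y by apply: lt_le_trans p0 _; apply: pmf_of_le => t [_ -> ->].
  have z0 : 0 < pz by apply: lt_le_trans p0 _; apply: pmf_of_le => t [_ _ ->].
  rewrite ln_div ?posrE ?mulr_gt0// !lnM ?posrE// /xlnx; ring.
transitivity (\sum_x \sum_y
    (xlnx (pxyz x y) + pxyz x y * ln pz - pxyz x y * ln (pxz x) - pxyz x y * ln (pyz y))).
  rewrite mulr_suml; apply: eq_bigr => x _; rewrite mulr_suml.
  by apply: eq_bigr => y _; exact: term.
have swap (V : finType) (W : T -> V) w :
    pmf_of P (fun t => (W t, Z t)) (w, z) = pmf_of P (fun t => (Z t, W t)) (z, w).
  by apply: eq_bigl => t; rewrite !xpair_eqE andbC.
have sy x : \sum_y pxyz x y = pxz x.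
  rewrite /pxz (pmf_of_marginal _ _ _ Y); apply: eq_bigr => y _; apply: eq_bigl => t.
  by rewrite !xpair_eqE andbAC.
have sx y : \sum_x pxyz x y = pyz y.
  rewrite /pyz (pmf_of_marginal _ _ _ X); apply: eq_bigr => x _; apply: eq_bigl => t.
  by rewrite !xpair_eqE -andbA andbC.
have sxz : \sum_x pxz x = pz.
  by rewrite /pz (pmf_of_marginal _ _ _ X); apply: eq_bigr => x _; rewrite /pxz swap.
have row x : \sum_y
    (xlnx (pxyz x y) + pxyz x y * ln pz - pxyz x y * ln (pxz x) - pxyz x y * ln (pyz y))
    = \sum_y xlnx (pxyz x y) + pxz x * ln pz - xlnx (pxz x) - \sum_y pxyz x y * ln (pyz y).
  by rewrite !sumrB big_split/= -!mulr_suml sy.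
rewrite (eq_bigr _ (fun x _ => row x)) !sumrB big_split/= -mulr_suml sxz; congr (_ + _ - _ - _).
rewrite exchange_big/=; apply: eq_bigr => y _.
by rewrite -mulr_suml sx.
Qed.

Lemma pmf_of_null_cost (A B : finType) (c : A -> R) (X : T -> A) (Y : T -> B) (b : B) (a : A) :
  (forall x, 0 <= c x) -> mean P (fun t => c (X t)) = 0 -> c a != 0 ->
  (forall t, Y t = b -> X t = a) -> pmf_of P Y b = 0.
Proof.
move=> c0 mc ca XY; apply: big1 => t /eqP/XY Xt; move/eqP: mc.
rewrite /mean psumr_eq0 => [/allP/(_ t)|u _]; last exact: mulr_ge0.
by rewrite mem_index_enum => /(_ isT)/=; rewrite Xt mulf_eq0 (negbTE ca) orbF => /eqP.
Qed.

End Marginals.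

Section SumRate.
Variables (R : realType) (AQ AU1 AU2 T : finType) (P : T -> R).
Variables (Q : T -> AQ) (S1 S2 X1 X2 Y : T -> 'Z_4) (U1 : T -> AU1) (U2 : T -> AU2).
Variables (pQ : AQ -> R) (k1 : 'Z_4 -> AQ -> AU1 * 'Z_4 -> R) (k2 : 'Z_4 -> AQ -> AU2 * 'Z_4 -> R).
Hypotheses (P_pmf : is_pmf P) (pQ_pmf : is_pmf pQ).
Hypotheses (k1_pmf : forall s q, is_pmf (k1 s q)) (k2_pmf : forall s q, is_pmf (k2 s q)).
Hypothesis factorization : forall q s1 s2 u1 u2 x1 x2 y,
  pmf_of P (fun t => (Q t, S1 t, S2 t, U1 t, U2 t, X1 t, X2 t, Y t))
    (q, s1, s2, u1, u2, x1, x2, y)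
  = pQ q * uniform_pmf R s1 * uniform_pmf R s2 * k1 s1 q (u1, x1) * k2 s2 q (u2, x2)
    * noiseless_mac4 R x1 x2 s1 s2 y.
Hypotheses (mean_cost1 : mean P (fun t => cost1 R (X1 t)) = 0)
  (mean_cost2 : mean P (fun t => cost2 R (X2 t)) = 0).

Let g1 q u s x := uniform_pmf R s * k1 s q (u, x).
Let g2 q u s x := uniform_pmf R s * k2 s q (u, x).
Let M1 q u := \sum_s \sum_x g1 q u s x.
Let M2 q u := \sum_s \sum_x g2 q u s x.

Let P_ge0 t : 0 <= P t. Proof. by case: P_pmf. Qed.
Let pQ_ge0 q : 0 <= pQ q. Proof. by case: pQ_pmf. Qed.

Let uniform_sum : \sum_(s : 'Z_4) uniform_pmf R s = 1.
Proof. by rewrite /uniform_pmf sumr_const card_ord -[LHS]mulr_natl mulfV ?pnatr_eq0. Qed.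

Let g1_ge0 q u s x : 0 <= g1 q u s x.
Proof. by rewrite mulr_ge0 ?invr_ge0//; case: (k1_pmf s q). Qed.

Let g2_ge0 q u s x : 0 <= g2 q u s x.
Proof. by rewrite mulr_ge0 ?invr_ge0//; case: (k2_pmf s q). Qed.

Let g1_sum_state q s : \sum_u \sum_x g1 q u s x = uniform_pmf R s.
Proof.
rewrite pair_bigA/= -[RHS]mulr1; case: (k1_pmf s q) => _ <-; rewrite mulr_sumr.
by apply: eq_bigr => -[].
Qed.

Let g2_sum_state q s : \sum_u \sum_x g2 q u s x = uniform_pmf R s.
Proof.
rewrite pair_bigA/= -[RHS]mulr1; case: (k2_pmf s q) => _ <-; rewrite mulr_sumr.
by apply: eq_bigr => -[].
Qed.

Let g1_sum q : \sum_u \sum_s \sum_x g1 q u s x = 1.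
Proof. by rewrite exchange_big/= (eq_bigr _ (fun s _ => g1_sum_state q s)). Qed.

Let g2_sum q : \sum_u \sum_s \sum_x g2 q u s x = 1.
Proof. by rewrite exchange_big/= (eq_bigr _ (fun s _ => g2_sum_state q s)). Qed.

Let joint q s1 s2 u1 u2 x1 x2 y :
  pmf_of P (fun t => (Q t, S1 t, S2 t, U1 t, U2 t, X1 t, X2 t, Y t))
    (q, s1, s2, u1, u2, x1, x2, y)
  = pQ q * (g1 q u1 s1 x1 * g2 q u2 s2 x2 * noiseless_mac4 R x1 x2 s1 s2 y).
Proof. by rewrite factorization /g1 /g2; ring. Qed.

(** The variables of the other user and the output sum out to 1 in the factorised joint law. The
    remaining marginals are obtained by further summation. *)
Let pUSXQ1 u s x q :
  pmf_of P (fun t => (U1 t, S1 t, X1 t, Q t)) (u, s, x, q) = pQ q * g1 q u s x.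
Proof.
transitivity (\sum_u2 \sum_s2 \sum_x2 \sum_y
    pQ q * (g1 q u s x * g2 q u2 s2 x2 * noiseless_mac4 R x x2 s s2 y)).
  rewrite (@pmf_of_marginal _ _ _ _ _ _ U2); apply: eq_bigr => u2 _.
  rewrite (@pmf_of_marginal _ _ _ _ _ _ S2); apply: eq_bigr => s2 _.
  rewrite (@pmf_of_marginal _ _ _ _ _ _ X2); apply: eq_bigr => x2 _.
  rewrite (@pmf_of_marginal _ _ _ _ _ _ Y); apply: eq_bigr => y _.
  rewrite -joint; apply: eq_bigl => t; rewrite !xpair_eqE.
  by do !case: (_ == _).
rewrite -[RHS]mulr1 -(g2_sum q) mulr_sumr; apply: eq_bigr => u2 _.
rewrite mulr_sumr; apply: eq_bigr => s2 _; rewrite mulr_sumr; apply: eq_bigr => x2 _.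
by rewrite -!mulr_sumr sum_noiseless mulr1 mulrA.
Qed.

Let pUSXQ2 u s x q :
  pmf_of P (fun t => (U2 t, S2 t, X2 t, Q t)) (u, s, x, q) = pQ q * g2 q u s x.
Proof.
transitivity (\sum_u1 \sum_s1 \sum_x1 \sum_y
    pQ q * (g1 q u1 s1 x1 * g2 q u s x * noiseless_mac4 R x1 x s1 s y)).
  rewrite (@pmf_of_marginal _ _ _ _ _ _ U1); apply: eq_bigr => u1 _.
  rewrite (@pmf_of_marginal _ _ _ _ _ _ S1); apply: eq_bigr => s1 _.
  rewrite (@pmf_of_marginal _ _ _ _ _ _ X1); apply: eq_bigr => x1 _.
  rewrite (@pmf_of_marginal _ _ _ _ _ _ Y); apply: eq_bigr => y _.
  rewrite -joint; apply: eq_bigl => t; rewrite !xpair_eqE.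
  by do !case: (_ == _).
rewrite -[RHS]mulr1 -(g1_sum q) mulr_sumr; apply: eq_bigr => u1 _.
rewrite mulr_sumr; apply: eq_bigr => s1 _; rewrite mulr_sumr; apply: eq_bigr => x1 _.
by rewrite -!mulr_sumr sum_noiseless mulr1 (mulrC (g1 _ _ _ _)) mulrA.
Qed.

Let pUYQ u1 u2 y q :
  pmf_of P (fun t => (U1 t, U2 t, Y t, Q t)) (u1, u2, y, q) = pQ q *
  \sum_s1 \sum_x1 \sum_x2 \sum_s2 g1 q u1 s1 x1 * g2 q u2 s2 x2 * noiseless_mac4 R x1 x2 s1 s2 y.
Proof.
rewrite (@pmf_of_marginal _ _ _ _ _ _ S1) mulr_sumr; apply: eq_bigr => s1 _.
rewrite (@pmf_of_marginal _ _ _ _ _ _ X1) mulr_sumr; apply: eq_bigr => x1 _.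
rewrite (@pmf_of_marginal _ _ _ _ _ _ X2) mulr_sumr; apply: eq_bigr => x2 _.
rewrite (@pmf_of_marginal _ _ _ _ _ _ S2) mulr_sumr; apply: eq_bigr => s2 _.
rewrite -joint; apply: eq_bigl => t; rewrite !xpair_eqE.
by do !case: (_ == _).
Qed.

Let pUSQ1 u s q :
  pmf_of P (fun t => (U1 t, S1 t, Q t)) (u, s, q) = pQ q * \sum_x g1 q u s x.
Proof.
rewrite (@pmf_of_marginal _ _ _ _ _ _ X1) mulr_sumr; apply: eq_bigr => x _.
rewrite -pUSXQ1; apply: eq_bigl => t; rewrite !xpair_eqE.
by do !case: (_ == _).
Qed.

Let pUSQ2 u s q :
  pmf_of P (fun t => (U2 t, S2 t, Q t)) (u, s, q) = pQ q * \sum_x g2 q u s x.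
Proof.
rewrite (@pmf_of_marginal _ _ _ _ _ _ X2) mulr_sumr; apply: eq_bigr => x _.
rewrite -pUSXQ2; apply: eq_bigl => t; rewrite !xpair_eqE.
by do !case: (_ == _).
Qed.

Let pUQ1 u q : pmf_of P (fun t => (U1 t, Q t)) (u, q) = pQ q * M1 q u.
Proof.
rewrite (@pmf_of_marginal _ _ _ _ _ _ S1) mulr_sumr; apply: eq_bigr => s _.
rewrite -pUSQ1; apply: eq_bigl => t; rewrite !xpair_eqE.
by do !case: (_ == _).
Qed.

Let pUQ2 u q : pmf_of P (fun t => (U2 t, Q t)) (u, q) = pQ q * M2 q u.
Proof.
rewrite (@pmf_of_marginal _ _ _ _ _ _ S2) mulr_sumr; apply: eq_bigr => s _.
rewrite -pUSQ2; apply: eq_bigl => t; rewrite !xpair_eqE.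
by do !case: (_ == _).
Qed.

Let pSQ1 s q : pmf_of P (fun t => (S1 t, Q t)) (s, q) = pQ q * uniform_pmf R s.
Proof.
rewrite -(g1_sum_state q) (@pmf_of_marginal _ _ _ _ _ _ U1) mulr_sumr; apply: eq_bigr => u _.
rewrite -pUSQ1; apply: eq_bigl => t; rewrite !xpair_eqE.
by do !case: (_ == _).
Qed.

Let pSQ2 s q : pmf_of P (fun t => (S2 t, Q t)) (s, q) = pQ q * uniform_pmf R s.
Proof.
rewrite -(g2_sum_state q) (@pmf_of_marginal _ _ _ _ _ _ U2) mulr_sumr; apply: eq_bigr => u _.
rewrite -pUSQ2; apply: eq_bigl => t; rewrite !xpair_eqE.
by do !case: (_ == _).
Qed.

Let pQE q : pmf_of P Q q = pQ q.
Proof.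
rewrite -[RHS]mulr1 -uniform_sum mulr_sumr (@pmf_of_marginal _ _ _ _ _ _ S1).
apply: eq_bigr => s _; rewrite -pSQ1; apply: eq_bigl => t; rewrite !xpair_eqE.
by do !case: (_ == _).
Qed.

Let pUQ u1 u2 q :
  pmf_of P (fun t => (U1 t, U2 t, Q t)) (u1, u2, q) = pQ q * (M1 q u1 * M2 q u2).
Proof.
rewrite -sum_output mulr_sumr (@pmf_of_marginal _ _ _ _ _ _ Y); apply: eq_bigr => y _.
rewrite -pUYQ; apply: eq_bigl => t; rewrite !xpair_eqE.
by do !case: (_ == _).
Qed.

(** A nonnegative cost of zero mean vanishes on every atom of positive mass. At a null [q] the
    kernel is unconstrained. *)
Let g1_cost q : pQ q != 0 -> forall u s, g1 q u s 1 = 0 /\ g1 q u s 3 = 0.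
Proof.
move=> q0 u s.
have key x : cost1 R x != 0 -> g1 q u s x = 0.
  move=> cx; apply: (mulfI q0); rewrite mulr0 -pUSXQ1.
  apply: (@pmf_of_null_cost _ _ _ P_ge0 _ _ _ _ _ _ x _ mean_cost1) => //.
  - by move=> z; rewrite /cost1; case: ifP.
  - by move=> t [].
by split; apply: key; rewrite /cost1/= oner_eq0.
Qed.

Let g2_cost q : pQ q != 0 -> forall u s, g2 q u s 2 = 0 /\ g2 q u s 3 = 0.
Proof.
move=> q0 u s.
have key x : cost2 R x != 0 -> g2 q u s x = 0.
  move=> cx; apply: (mulfI q0); rewrite mulr0 -pUSXQ2.
  apply: (@pmf_of_null_cost _ _ _ P_ge0 _ _ _ _ _ _ x _ mean_cost2) => //.
  - by move=> z; rewrite /cost2; case: ifP.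
  - by move=> t [].
by split; apply: key; rewrite /cost2/= oner_eq0.
Qed.

Let neg_entropy_uniform (p : R) : 0 <= p ->
  \sum_(s : 'Z_4) xlnx (p * uniform_pmf R s) = xlnx p - 2 * p * ln 2.
Proof.
move=> p0; have uE (s : 'Z_4) : uniform_pmf R s = 2^-1 * 2^-1.
  by rewrite /uniform_pmf card_ord -invfM -natrM.
rewrite sum_Z4 !uE !xlnxM ?mulr_ge0 ?invr_ge0// [xlnx 2^-1]/xlnx lnV ?posrE//; lra.
Qed.

(** Four values carry at most two bits: the masses are merged in pairs, then the two pairs, at one
    bit per level. *)
Let neg_entropy_output q :
  xlnx (pQ q) - 2 * pQ q * ln 2 <= \sum_y xlnx (pmf_of P (fun t => (Y t, Q t)) (y, q)).
Proof.
have -> : pQ q = \sum_y pmf_of P (fun t => (Y t, Q t)) (y, q).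
  rewrite -pQE (@pmf_of_marginal _ _ _ _ _ _ Y); apply: eq_bigr => y _.
  by apply: eq_bigl => t; rewrite !xpair_eqE andbC.
rewrite !sum_Z4; set a := pmf_of _ _ (0, q); set b := pmf_of _ _ (1, q).
set c := pmf_of _ _ (2, q); set d := pmf_of _ _ (3, q).
have [a0 b0 c0 d0] : [/\ 0 <= a, 0 <= b, 0 <= c & 0 <= d] by split; exact: pmf_of_ge0.
have := xlnxD_half _ _ a0 b0; have := xlnxD_half _ _ c0 d0.
have := xlnxD_half _ _ (addr_ge0 a0 b0) (addr_ge0 c0 d0).
rewrite addrA; lra.
Qed.

(** For each [q], the terms H(Y|U1,U2), H(S1|U1) and H(S2|U2) contribute at most 2.32 bits, H(Y) at
    most 2, and the uniform states exactly -4, which leaves 0.32. *)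
Lemma sum_rate_le :
  cond_mutual_info P (fun t => (U1 t, U2 t)) Y Q - cond_mutual_info P U1 S1 Q
  - cond_mutual_info P U2 S2 Q <= 32 / 100.
Proof.
rewrite -(ler_pM2r (@ln2_gt0 R)) !mulrBl !cond_mutual_info_xlnx// -!sumrB.
have -> : 32 / 100 * ln 2 = \sum_q pQ q * (32 / 100 * ln 2).
  by rewrite -mulr_suml; case: pQ_pmf => _ ->; rewrite mul1r.
apply: ler_sum => q _.
have := sum_neg_entropy_le _ _ _ _ _ _ (pQ_ge0 q) (g1_ge0 q) (g2_ge0 q)
  (g1_sum q) (g2_sum q) (g1_cost q) (g2_cost q).
have <- : \sum_x \sum_y xlnx (pmf_of P (fun t => (U1 t, U2 t, Y t, Q t)) (x, y, q))
    - \sum_x xlnx (pmf_of P (fun t => (U1 t, U2 t, Q t)) (x, q))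
  = \sum_u1 \sum_u2 (\sum_y xlnx (pQ q * \sum_s1 \sum_x1 \sum_x2 \sum_s2
      g1 q u1 s1 x1 * g2 q u2 s2 x2 * noiseless_mac4 R x1 x2 s1 s2 y)
    - xlnx (pQ q * (M1 q u1 * M2 q u2))).
  rewrite -sumrB pair_bigA/=; apply: eq_bigr => -[u1 u2] _; rewrite pUQ; congr (_ - _).
  by apply: eq_bigr => y _; rewrite pUYQ.
have <- : \sum_x \sum_y xlnx (pmf_of P (fun t => (U1 t, S1 t, Q t)) (x, y, q))
    - \sum_x xlnx (pmf_of P (fun t => (U1 t, Q t)) (x, q))
  = \sum_u (\sum_s xlnx (pQ q * \sum_x g1 q u s x) - xlnx (pQ q * M1 q u)).
  rewrite -sumrB; apply: eq_bigr => u _; rewrite pUQ1; congr (_ - _).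
  by apply: eq_bigr => s _; rewrite pUSQ1.
have <- : \sum_x \sum_y xlnx (pmf_of P (fun t => (U2 t, S2 t, Q t)) (x, y, q))
    - \sum_x xlnx (pmf_of P (fun t => (U2 t, Q t)) (x, q))
  = \sum_u (\sum_s xlnx (pQ q * \sum_x g2 q u s x) - xlnx (pQ q * M2 q u)).
  rewrite -sumrB; apply: eq_bigr => u _; rewrite pUQ2; congr (_ - _).
  by apply: eq_bigr => s _; rewrite pUSQ2.
have eS1 : \sum_y xlnx (pmf_of P (fun t => (S1 t, Q t)) (y, q)) = xlnx (pQ q) - 2 * pQ q * ln 2.
  by rewrite -neg_entropy_uniform//; apply: eq_bigr => s _; rewrite pSQ1.
have eS2 : \sum_y xlnx (pmf_of P (fun t => (S2 t, Q t)) (y, q)) = xlnx (pQ q) - 2 * pQ q * ln 2.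
  by rewrite -neg_entropy_uniform//; apply: eq_bigr => s _; rewrite pSQ2.
have := neg_entropy_output q; rewrite pQE eS1 eS2; lra.
Qed.

End SumRate.

(** * Passage to the closed convex hull *)

Lemma gp_pairs_sum_rate (R : realType) (r : R^o * R^o) :
  gp_pairs (@noiseless_mac4 R) (@uniform_pmf R 'Z_4) (@uniform_pmf R 'Z_4)
    (@cost1 R) (@cost2 R) r -> r.1 + r.2 <= 32 / 100.
Proof.
case=> AQ [AU1] [AU2] [T] [P] [Q] [S1] [S2] [U1] [U2] [X1] [X2] [Y] /=.
case=> P_pmf [pQ] [k1] [k2] [pQ_pmf k1_pmf k2_pmf fact] [c1 c2] _ [_ _ h].
by apply: le_trans h _; apply: (sum_rate_le _ _ _ _ _ _ _ _ _ _ _ _ _ _ _ _ _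
  P_pmf pQ_pmf k1_pmf k2_pmf fact c1 c2).
Qed.

Theorem lemma3 (R : realType) (R1 R2 : R) :
  gp_region (@noiseless_mac4 R)
    (@uniform_pmf R 'Z_4) (@uniform_pmf R 'Z_4)
    (@cost1 R) (@cost2 R) (R1, R2) ->
  R1 + R2 <= 32 / 100.
Proof.
(* This half-plane is closed and convex, so it contains the whole region as soon as it contains
   [gp_pairs]. *)
pose H : set (R^o * R^o) := [set r | r.1 + r.2 <= 32 / 100].
suff : gp_region (@noiseless_mac4 R) (@uniform_pmf R 'Z_4) (@uniform_pmf R 'Z_4)
    (@cost1 R) (@cost2 R) `<=` H by move=> /[apply].
rewrite /gp_region closureE; apply: smallest_sub.
  apply: (@preimage_closed _ _ (fun r : R^o * R^o => r.1 + r.2) [set x : R | x <= 32 / 100]).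
    by move=> r _; apply: (@continuousD R R^o); [exact: cvg_fst|exact: cvg_snd].
  exact: closed_le.
apply: smallest_sub; last exact: gp_pairs_sum_rate.
move=> x y l; rewrite !inE /H/= => hx hy.
change (l%:num * x.1 + (1 - l%:num) * y.1 + (l%:num * x.2 + (1 - l%:num) * y.2) <= 32 / 100).
have l0 : 0 <= l%:num by [].
have l1 : 0 <= 1 - l%:num by rewrite subr_ge0.
have := ler_wpM2l l0 hx; have := ler_wpM2l l1 hy; lra.
Qed.
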